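(* Let $\aleph$ be an uncountable cardinal. For a compact Hausdorff space $K$ the following are equivalent: (1) $K$ is a zero-dimensional $F_\aleph$-space. (2) $K$ is projective with respect to the class of continuous surjections $\pi:L\to M$ between compact Hausdorff spaces such that $w(L)<\aleph$. (3) $K$ is projective with respect to the class of continuous surjections $\pi:L\to M$ between compact Hausdorff spaces such that $w(M)<\aleph$ and $w(L)\leq\aleph$. (4) $K$ is projective with respect to the class of continuous surjections $\pi:L\to M$ between compact Hausdorff spaces with $L\in H\!L_\aleph$.
   Context: $w(\cdot)$ denotes the weight of a topological space. A compact space $K$ is an $F_\aleph$-space if any two disjoint open subsets of $K$, each of which is the union of less than $\aleph$ many closed sets, have disjoint closures. If $\mathscr C$ is a class of continuous surjections between compact spaces, a compact space $K$ is projective with respect to $\mathscr C$ if for every $\pi:L\to M$ in $\mathscr C$ and every continuous map $f:K\to M$ there is a continuous map $g:K\to L$ with $\pi g=f$. $H\!L_\aleph$ is the class of compact spaces $K$ such that every open subset of $K$ is the union of less than $\aleph$ many closed subsets of $K$ (equivalently, every open cover of every subspace of $K$ has a subcover of cardinality less than $\aleph$). *)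

(* Defs.v *)
From HB Require Import structures.
From mathcomp Require Import all_boot.
From mathcomp Require Import boolp classical_sets functions cardinality filter.
From mathcomp Require Import topology.

Set Implicit Arguments.
Unset Strict Implicit.
Unset Printing Implicit Defensive.

Local Open Scope classical_set_scope.
Local Open Scope card_scope.

(* A cardinal is represented by any set having that cardinality. *)
Definition card_lt (T U : Type) (A : set T) (B : set U) : bool :=
  (A #<= B) && ~~ (B #<= A).

Notation "A '#<' B" := (card_lt A B)
  (at level 79, format "A  '#<'  B") : card_scope.

Lemma ex_min_card (U : pointedType) (S : set (set U)) :
  S !=set0 -> exists2 B, S B & forall B', S B' -> B #<= B'.
Proof.
move=> [B0 SB0].
pose P (F : set (set U -> U)) :=
  (forall f B, F f -> S B -> B (f B)) /\
  (forall f g B, F f -> F g -> S B -> f B = g B -> f = g).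
have [F [[FS Finj] Fmax]] : exists F, P F /\ forall G, F `<` G -> ~ P G.
  apply: Zorn_bigcup => C CP Ctot; split.
    by move=> f B [X CX Xf] SB; have [/(_ f B Xf SB)] := CP _ CX.
  move=> f g B [X CX Xf] [Y CY Yg] SB fg.
  have [XY|YX] := Ctot _ _ CX CY.
    by have [_ /(_ f g B (XY _ Xf) Yg SB fg)] := CP _ CY.
  by have [_ /(_ f g B Xf (YX _ Yg) SB fg)] := CP _ CX.
have [B [SB FB]] : exists B, S B /\ B `<=` [set f B | f in F].
  apply: contrapT => /forallNP noB.
  pose h B := get (B `\` [set f B | f in F]).
  have hP B : S B -> (B `\` [set f B | f in F]) (h B).
    move=> SB; have := noB B; rewrite not_andE => -[//|].
    rewrite -existsNP => -[x /not_implyP[Bx nFx]].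
    by apply: (@getPex _ (B `\` [set f B | f in F])); exists x.
  apply: (Fmax (F `|` [set h])).
    split; first exact: subsetUl.
    by move=> /(_ h (or_intror erefl)) Fh; have [_] := hP _ SB0; apply; exists h.
  split=> [f B [Ff|->] SB|f g B [Ff|->] [Fg|->] SB fg //].
  - exact: FS f B Ff SB.
  - by have [] := hP _ SB.
  - exact: (Finj _ _ _ Ff Fg SB fg).
  - by have [_] := hP _ SB; case; exists f.
  - by have [_] := hP _ SB; case; exists g.
exists B => // B' SB'.
have BF : B #<= F.
  apply: (card_le_trans (subset_card_le FB)); exact: card_image_le.
apply: (card_le_trans BF).
have inF : {in F &, injective (fun f : set U -> U => f B')}.
  by move=> f g /set_mem Ff /set_mem Fg; exact: Finj.
have := inj_card_eq inF; rewrite card_eq_le => /andP[_ /card_le_trans]; apply.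
by apply: subset_card_le => _ [f Ff <-]; exact: FS f B' Ff SB'.
Qed.

(* w(T), represented by a base of T of least cardinality. *)
Definition weight (T : topologicalType) : set (set T) :=
  get [set B | basis B /\ forall B' : set (set T), basis B' -> B #<= B'].
Arguments weight : clear implicits.

Lemma basis_open (T : topologicalType) : basis (@open T).
Proof.
split=> // x A; rewrite nbhsE => -[B [oB Bx] BA].
by exists B.
Qed.

Lemma weightP (T : topologicalType) :
  basis (weight T) /\ forall B : set (set T), basis B -> weight T #<= B.
Proof.
have [|B Bb Bmin] := @ex_min_card (set T) (@basis T).
  by exists open; exact: basis_open.
by apply: (@getPex _ [set B | basis B /\ forall B', basis B' -> B #<= B']);
  exists B.
Qed.

Definition compact_hausdorff (T : topologicalType) : Prop :=
  compact [set: T] /\ hausdorff_space T.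

(* Stronger in general than the library's [zero_dimensional], which only asks
   that clopen sets separate points. *)
Definition clopen_basis (T : topologicalType) : Prop :=
  basis [set U : set T | clopen U].

Definition union_of_few_closed (A : Type) (T : topologicalType) (U : set T) :
    Prop :=
  exists F : set (set T),
    [/\ F #< [set: A], F `<=` closed & U = \bigcup_(C in F) C].

Definition F_space (A : Type) (K : topologicalType) : Prop :=
  forall U V : set K,
    open U -> open V -> union_of_few_closed A U -> union_of_few_closed A V ->
    U `&` V = set0 -> closure U `&` closure V = set0.

Definition HL (A : Type) (L : topologicalType) : Prop :=
  forall U : set L, open U -> union_of_few_closed A U.

Definition projective (C : forall L M : topologicalType, (L -> M) -> Prop)
    (K : topologicalType) : Prop :=
  forall (L M : topologicalType) (p : L -> M), C L M p ->
  forall f : K -> M, continuous f ->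
  exists2 g : K -> L, continuous g & p \o g = f.

Definition compact_surjection (L M : topologicalType) (p : L -> M) : Prop :=
  [/\ compact_hausdorff L, compact_hausdorff M, continuous p
    & set_surj [set: L] [set: M] p].

(* Main.v *)
Require Import Defs.
From mathcomp Require Import all_boot all_order all_algebra.
From mathcomp Require Import boolp classical_sets functions cardinality filter.
From mathcomp Require Import wochoice reals Rstruct topology normedtype.

(* Idea of (1) => (3), (4).  Given a surjection [p : L -> M] and a map
   [f : K -> M], a lift is a closed selection of the closed relation
   [E0 = {(k, l) | f k = p l}].  Shrink [E0] by a transfinite sequence of
   closed relations [E] with nonempty fibers, each step making one more
   continuous function [h : L -> R] constant on the fibers.  A step needs a
   continuous [v : K -> R] with [v k] in [h (E k)]: for each rational [q], the
   disjoint open sets of those [k] with [E k] inside [{h < q}], respectively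
   inside [{h > q}], are unions of few closed sets, so the F-space property and
   zero-dimensionality give a clopen set separating them, and cutting [E] along
   all these clopen sets, one rational after the other, leaves a single value
   of [h] on each fiber.
   The smallness of those open sets holds because [E] is the relation of a map
   from [K] to a quotient of [L]; that quotient inherits the HL property from
   [L] in case (4), and has small weight in case (3), where the functions [h]
   are enumerated in a well order with small initial segments.

   Conversely, if the closed sets [X] and [Y] cover [K] and are unions of fibers
   of a map [e] from [K] to a small cube, lifting [e] through the projection
   from the disjoint union of [e X] and [e Y] to [e K] yields a clopen set [P]
   inside [X] with complement inside [Y].  Urysohn functions put both
   zero-dimensionality and the F-space property into this form. *)

Set Implicit Arguments.
Unset Strict Implicit.
Unset Printing Implicit Defensive.

Import Order.TTheory GRing.Theory Num.Theory.
Import numFieldNormedType.Exports.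
Local Open Scope classical_set_scope.
Local Open Scope card_scope.

(** * Cardinal arithmetic *)

(** A relation instead of a function [T -> U]: no such function need exist when [X] and [U] are
    empty. [r] may relate a point to several others, since a choice among them remains injective. *)
Definition injects T U (X : set T) (Y : set U) (r : T -> U -> Prop) : Prop :=
  (forall x, X x -> exists2 y, Y y & r x y) /\
  (forall x x' y, X x -> X x' -> r x y -> r x' y -> x = x').

Lemma card_le_relP T U (X : set T) (Y : set U) :
  (X #<= Y) <-> exists r, injects X Y r.
Proof.
split=> [/card_leP[f]|[r [rY rinj]]].
  exists (fun x y => exists x' : X, set_val x' = x /\ set_val (f x') = y); split.
    move=> x Xx; exists (set_val (f (SigSub (mem_set Xx)))).
      exact: set_valP.
    by exists (SigSub (mem_set Xx)).
  move=> x x' y _ _ [a [<- <-]] [b [<- /val_inj/inj ab]].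
  by rewrite ab ?inE.
have [->|/set0P[x0 Xx0]] := eqVneq X set0; first exact: card_ge0.
have [y0 Yy0 _] := rY _ Xx0.
have /choice[f fP] : forall x, exists y, X x -> Y y /\ r x y.
  move=> x; have [Xx|nXx] := pselect (X x); last by exists y0.
  by have [y Yy rxy] := rY _ Xx; exists y.
have finj : {in X &, injective f}.
  move=> x x' /set_mem Xx /set_mem Xx' fxx'.
  have [_ rx] := fP _ Xx; have [_ rx'] := fP _ Xx'.
  by apply: (rinj x x' (f x)) => //; rewrite fxx'.
have := inj_card_eq finj; rewrite card_eq_le => /andP[_ /card_le_trans]; apply.
by apply: subset_card_le => _ [x Xx <-]; have [] := fP _ Xx.
Qed.

Lemma card_le_inj T U (X : set T) (Y : set U) (f : T -> U) :
  (forall x, X x -> Y (f x)) ->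
  (forall x x', X x -> X x' -> f x = f x' -> x = x') -> X #<= Y.
Proof.
move=> fY finj; apply/card_le_relP; exists (fun x y => f x = y); split.
  by move=> x Xx; exists (f x) => //; exact: fY.
by move=> x x' y Xx Xx' <- /esym; exact: finj.
Qed.

Lemma card_le_fun T U (X : set T) (Y : set U) : X !=set0 -> X #<= Y ->
  exists f : T -> U, (forall x, X x -> Y (f x)) /\
  (forall x x', X x -> X x' -> f x = f x' -> x = x').
Proof.
move=> [x0 Xx0] /card_le_relP[r [rY rinj]].
have [y0 Yy0 _] := rY _ Xx0.
have /choice[f fP] : forall x, exists y, X x -> Y y /\ r x y.
  move=> x; have [Xx|nXx] := pselect (X x); last by exists y0.
  by have [y Yy rxy] := rY _ Xx; exists y.
exists f; split=> [x /fP[]//|x x' Xx Xx' fxx'].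
have [_ rx] := fP _ Xx; have [_ rx'] := fP _ Xx'.
by apply: (rinj x x' (f x)) => //; rewrite fxx'.
Qed.

(** Zorn's lemma gives a maximal graph of a partial injection. If it missed a point of [X] and a
    point of [Y], that pair could be added to it. *)
Lemma card_le_total T U (X : set T) (Y : set U) : (X #<= Y) \/ (Y #<= X).
Proof.
pose P (G : set (T * U)) :=
  [/\ (forall x y, G (x, y) -> X x /\ Y y),
      (forall x y y', G (x, y) -> G (x, y') -> y = y') &
      (forall x x' y, G (x, y) -> G (x', y) -> x = x')].
have [G [[GXY Gf Gi] Gmax]] : exists G, P G /\ forall G', G `<` G' -> ~ P G'.
  apply: Zorn_bigcup => C CP Ctot; split.
  - by move=> x y [G CG Gxy]; have [/(_ x y Gxy)] := CP _ CG.
  - move=> x y y' [G CG Gxy] [G' CG' Gxy'].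
    have [GG|GG] := Ctot _ _ CG CG'.
      by have [_ /(_ x y y' (GG _ Gxy) Gxy')] := CP _ CG'.
    by have [_ /(_ x y y' Gxy (GG _ Gxy'))] := CP _ CG.
  - move=> x x' y [G CG Gxy] [G' CG' Gxy'].
    have [GG|GG] := Ctot _ _ CG CG'.
      by have [_ _ /(_ x x' y (GG _ Gxy) Gxy')] := CP _ CG'.
    by have [_ _ /(_ x x' y Gxy (GG _ Gxy'))] := CP _ CG.
have [XG|/existsNP[x0 /not_implyP[Xx0 nGx0]]] :=
    pselect (forall x, X x -> exists y, G (x, y)).
  left; apply/card_le_relP; exists (fun x y => G (x, y)); split.
    by move=> x /XG[y Gxy]; exists y => //; have [] := GXY _ _ Gxy.
  by move=> x x' y _ _; exact: Gi.
have [YG|/existsNP[y0 /not_implyP[Yy0 nGy0]]] :=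
    pselect (forall y, Y y -> exists x, G (x, y)).
  right; apply/card_le_relP; exists (fun y x => G (x, y)); split.
    by move=> y /YG[x Gxy]; exists x => //; have [] := GXY _ _ Gxy.
  by move=> y y' x _ _; exact: Gf.
exfalso; apply: (Gmax (G `|` [set (x0, y0)])).
  split; first exact: subsetUl.
  by move=> /(_ (x0, y0) (or_intror erefl)) Gxy; apply: nGx0; exists y0.
split.
- by move=> x y [/GXY//|[-> ->]].
- move=> x y y' [Gxy|[? ?]] [Gxy'|[? ?]]; subst => //; first exact: (Gf x).
    by case: nGx0; exists y.
  by case: nGx0; exists y'.
- move=> x x' y [Gxy|[? ?]] [Gxy'|[? ?]]; subst => //; first exact: (Gi x x' y).
    by case: nGy0; exists x.
  by case: nGy0; exists x'.
Qed.

Lemma card_le_setX T T' U U' (X : set T) (X' : set T') (Y : set U) (Y' : set U') :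
  X #<= Y -> X' #<= Y' -> X `*` X' #<= Y `*` Y'.
Proof.
move=> /card_le_relP[r [rY ri]] /card_le_relP[r' [rY' ri']].
apply/card_le_relP; exists (fun p q => r p.1 q.1 /\ r' p.2 q.2); split.
  move=> [x x'] [/= /rY[y Yy ry] /rY'[y' Yy' ry']].
  by exists (y, y').
move=> [x x'] [z z'] [y y'] [/= ? ?] [/= ? ?] [? ?] [? ?].
by rewrite (ri x z y)// (ri' x' z' y').
Qed.

(* A maximal pairing [D * D -> D] with [D] inside [X] has [D] equipotent to [X],
   for otherwise it extends to [D `|` D'] with [D'] a copy of [D] in [X `\` D]. *)
Lemma card_setX_infinite T (X : set T) : infinite_set X -> X `*` X #<= X.
Proof.
move=> Xinf.
(* [(x, y, z)] in [G] means that the pair [(x, y)] is sent to [z]. The domain is read off the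
   diagonal. Infinity is asked only of a nonempty [G], since the union of the empty chain must
   satisfy [P] as well. *)
pose D (G : set (T * T * T)) x := exists z, G (x, x, z).
pose P (G : set (T * T * T)) :=
  [/\ (forall x y z, G (x, y, z) -> [/\ D G x, D G y & D G z]),
      (forall x y, D G x -> D G y -> exists z, G (x, y, z)),
      (forall p p' z, G (p, z) -> G (p', z) -> p = p'),
      D G `<=` X & G !=set0 -> infinite_set (D G)].
have [G [[GD Gt Gi GX Ginf] Gmax]] : exists G, P G /\ forall G', G `<` G' -> ~ P G'.
  apply: Zorn_bigcup => C CP Ctot.
  have sub G : C G -> D G `<=` D (\bigcup_(G in C) G).
    by move=> CG x [z Gz]; exists z; exists G.
  split.
  - move=> x y z [G CG Gxyz]; have [/(_ _ _ _ Gxyz)[? ? ?] _ _ _ _] := CP _ CG.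
    by split; apply: sub CG _ _.
  - move=> x y [z [G CG Gz]] [z' [G' CG' Gz']].
    have [GG|GG] := Ctot _ _ CG CG'.
      have [_ /(_ x y) []] := CP _ CG'; first by exists z; exact: GG.
        by exists z'.
      by move=> t Gt; exists t; exists G'.
    have [_ /(_ x y) []] := CP _ CG; first by exists z.
      by exists z'; exact: GG.
    by move=> t Gt; exists t; exists G.
  - move=> p p' z [G CG Gxy] [G' CG' Gxy'].
    have [GG|GG] := Ctot _ _ CG CG'.
      by have [_ _ /(_ p p' z (GG _ Gxy) Gxy')] := CP _ CG'.
    by have [_ _ /(_ p p' z Gxy (GG _ Gxy'))] := CP _ CG.
  - by move=> x [z [G CG Gz]]; have [_ _ _ + _] := CP _ CG; apply; exists z.
  - move=> [p [G CG Gp]]; have [_ _ _ _ /(_ (ex_intro _ _ Gp)) inf] := CP _ CG.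
    exact: sub_infinite_set (sub _ CG) inf.
have DD : D G `*` D G #<= D G.
  apply/card_le_relP; exists (fun p z => G (p, z)); split=> [[x y] [/= Dx Dy]|].
    by have [z Gz] := Gt _ _ Dx Dy; exists z => //; have [] := GD _ _ _ Gz.
  by move=> p p' z _ _; exact: Gi.
(* Otherwise a pairing of [nat], transported to a countable subset of [X], would extend [G]. *)
have G0 : G !=set0.
  apply/set0P/eqP => G0; have /infiniteP/(card_le_fun _)[] := Xinf.
    by exists 0%N.
  move=> f [fX fi].
  have [||g [_ gi]] := @card_le_fun _ _ [set: nat * nat] [set: nat].
    by exists (0%N, 0%N).
    by have := card_nat2; rewrite card_eq_le => /andP[].
  pose G' := [set t : T * T * T | exists n m, t = (f n, f m, f (g (n, m)))].
  have DG' : D G' = range f.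
    apply/seteqP; split=> [x [z [n [m [-> _ _]]]]|_ [n _ <-]]; first by exists n.
    by exists (f (g (n, n))); exists n, n.
  apply: (Gmax G').
    rewrite G0; split=> // /(_ (f 0%N, f 0%N, f (g (0, 0)%N))); apply.
    by exists 0%N, 0%N.
  split.
  - by move=> x y z [n [m [-> -> ->]]]; rewrite DG'; split; eexists.
  - rewrite DG' => _ _ [n _ <-] [m _ <-]; exists (f (g (n, m))); by exists n, m.
  - move=> p p' z [n [m [-> ->]]] [n' [m' [-> /fi]]].
    by move=> /(_ I I) /(gi _ _ I I) [-> ->].
  - by rewrite DG' => _ [n _ <-]; exact: fX.
  - move=> _; rewrite DG' infiniteP; apply: (@card_le_inj _ _ _ _ f).
      by move=> n _; exists n.
    by move=> *; exact: fi.
have Dinf := Ginf G0.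
have [d0 Dd0] := infinite_setN0 Dinf.
(* The two parts are tagged by distinct points [d0] and [d1], and [D G] absorbs its square. *)
have DU Y : Y #<= D G -> D G `|` Y #<= D G.
  move=> YD; apply: card_le_trans DD.
  have [d1 [Dd1 d01]] : (D G `\` [set d0]) !=set0.
    by apply: infinite_setN0; apply: infinite_setD => //; exact: finite_set1.
  move: YD => /card_le_relP[r [rD ri]].
  apply/card_le_relP; exists (fun x p => (p = (d0, x) /\ D G x) \/
     [/\ p.1 = d1, r x p.2, Y x & ~ D G x]); split.
    move=> x DYx; have [Dx|nDx] := pselect (D G x).
      by exists (d0, x) => //; left.
    by case: DYx => // Yx; have [y Dy rxy] := rD _ Yx; exists (d1, y) => //; right.
  move=> x x' [a b] _ _ [[[e1 e2] _]|[/= e1 rx Yx _]] [[[e3 e4] _]|[/= e3 rx' Yx' _]].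
  - by rewrite -e2 -e4.
  - by case: d01; rewrite /set1 /= -e3 e1.
  - by case: d01; rewrite /set1 /= -e1 e3.
  - exact: ri rx rx'.
have [XD|DX] := card_le_total (X `\` D G) (D G).
  have XD' : X #<= D G.
    apply: card_le_trans (DU _ XD); apply: subset_card_le => x Xx.
    by have [?|?] := pselect (D G x); [left|right].
  apply: card_le_trans (card_le_setX XD' XD') _; apply: card_le_trans DD _.
  exact: subset_card_le.
exfalso; have {DX} [f [fX fi]] := card_le_fun (infinite_setN0 Dinf) DX.
pose D' := f @` D G.
have D'D : D' #<= D G by exact: card_image_le.
have DD' : D G #<= D' by apply: (@card_le_inj _ _ _ _ f) => // x Dx; exists x.
have DU' : D G `|` D' #<= D G := DU _ D'D.
(* The pairs not yet treated get their values in [D'], which is disjoint from [D G], so they cannot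
   collide with the old values. *)
have : (D G `|` D') `*` (D G `|` D') #<= D'.
  by apply: card_le_trans (card_le_setX DU' DU') (card_le_trans DD DD').
move=> /card_le_fun [|g [gD' gi]]; first by exists (d0, d0); split; left.
pose N := [set t : T * T * T | ((D G `|` D') `*` (D G `|` D')) t.1
   /\ ~ (D G `*` D G) t.1 /\ g t.1 = t.2].
have NN x y : (D G `|` D') x -> (D G `|` D') y -> ~ (D G x /\ D G y) ->
  N (x, y, g (x, y)) by [].
have nD x : D' x -> ~ D G x by move=> [y Dy <-]; have [] := fX _ Dy.
have DN : D (G `|` N) = D G `|` D'.
  apply/seteqP; split=> [x [z [Gz|[[//]]]]|x [[z Gz]|D'x]].
  - by left; exists z.
  - by exists z; left.
  - by exists (g (x, x)); right; apply: NN; [right|right|move=> [/(nD _ D'x)]].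
apply: (Gmax (G `|` N)).
  split; first exact: subsetUl.
  move=> sub; apply: (nD (f d0)); first by exists d0.
  have : G (f d0, f d0, g (f d0, f d0)).
    apply: sub; right; apply: NN; try by right; exists d0.
    by move=> [+ _]; apply: nD; exists d0.
  by move=> /GD[].
have NX p z : N (p, z) -> D' z.
  by case=> /= pD [_ <-]; exact: gD'.
split.
- move=> x y z; rewrite DN => -[/GD[? ? ?]|H]; first by split; left.
  by have D'z := NX _ _ H; case: H => -[/= ? ?] _; split=> //; right.
- rewrite DN => x y Dx Dy; have [[Dx' Dy']|nD'] := pselect (D G x /\ D G y).
    by have [z Gz] := Gt _ _ Dx' Dy'; exists z; left.
  by exists (g (x, y)); right; exact: NN.
- move=> [x y] [x' y'] z [Gz|Nz] [Gz'|Nz'].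
  + exact: Gi Gz Gz'.
  + by have [] := nD _ (NX _ _ Nz'); have [] := GD _ _ _ Gz.
  + by have [] := nD _ (NX _ _ Nz); have [] := GD _ _ _ Gz'.
  + case: Nz Nz' => [/= H [_ <-]] [/= H' [_ /esym]]; exact: gi.
- rewrite DN => x [/GX//|[y Dy <-]]; by have [] := fX _ Dy.
- by move=> _; rewrite DN; apply: sub_infinite_set Dinf; exact: subsetUl.
Qed.

Section card_lt.
Variable A : Type.
Hypothesis hA : ~ countable [set: A].
Local Notation small X := (X #< [set: A]).

Lemma card_ltP T (X : set T) : small X <-> ~ ([set: A] #<= X).
Proof.
split=> [/andP[_ /negP]//|nAX]; apply/andP; split; last exact/negP.
by have [] := card_le_total X [set: A].
Qed.

Lemma card_lt_le T U (X : set T) (Y : set U) : Y #<= X -> small X -> small Y.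
Proof.
by move=> YX /card_ltP nX; apply/card_ltP => AY; apply: nX; exact: card_le_trans AY YX.
Qed.

Lemma countable_card_lt T (X : set T) : countable X -> small X.
Proof. by move=> cX; apply/card_ltP => /sub_countable/(_ cX). Qed.

(** A finite [X] is replaced by [nat], which is small because [A] is uncountable. Products of the
    resulting infinite sets are absorbed by [card_setX_infinite]. *)
Lemma infinite_card_lt T (X : set T) : small X ->
  exists U (Z : set U), [/\ infinite_set Z, X #<= Z & small Z].
Proof.
move=> Xs; have [Xfin|Xinf] := pselect (finite_set X); last by exists T, X.
exists nat, [set: nat]; split; first exact: infinite_nat.
  exact: finite_set_countable.
exact: countable_card_lt.
Qed.

Lemma card_lt_setX T U (X : set T) (Y : set U) :
  small X -> small Y -> small (X `*` Y).
Proof.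
move=> /infinite_card_lt[U1 [Z1 [i1 l1 s1]]] /infinite_card_lt[U2 [Z2 [i2 l2 s2]]].
apply: card_lt_le (card_le_setX l1 l2) _.
have [le|le] := card_le_total Z1 Z2.
  apply: card_lt_le (card_le_setX le (card_lexx _)) _.
  exact: card_lt_le (card_setX_infinite i2) s2.
apply: card_lt_le (card_le_setX (card_lexx _) le) _.
exact: card_lt_le (card_setX_infinite i1) s1.
Qed.

Lemma card_lt_setU T (X Y : set T) : small X -> small Y -> small (X `|` Y).
Proof.
move=> Xs Ys; have [->|/set0P[x0 Xx0]] := eqVneq X set0; first by rewrite set0U.
have [->|/set0P[y0 Yy0]] := eqVneq Y set0; first by rewrite setU0.
pose f (t : bool * (T * T)) := if t.1 then t.2.1 else t.2.2.
have sub : X `|` Y `<=` f @` ([set: bool] `*` (X `*` Y)).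
  by move=> x [Xx|Yx]; [exists (true, (x, y0))|exists (false, (x0, x))].
apply: card_lt_le (subset_card_le sub) _; apply: card_lt_le (card_image_le _ _) _.
by apply: card_lt_setX; [exact: countable_card_lt|exact: card_lt_setX].
Qed.

Fixpoint seq_in T (X : set T) (s : seq T) : Prop :=
  if s is x :: s' then X x /\ seq_in X s' else True.

Lemma card_lt_seq T (X : set T) : small X -> small [set s : seq T | seq_in X s].
Proof.
move=> /infinite_card_lt[U [Z [Zinf XZ Zs]]].
have /card_le_fun [] := card_setX_infinite Zinf.
  by have [z Zz] := infinite_setN0 Zinf; exists (z, z).
move=> p [pZ pi]; have [z0 Zz0] := infinite_setN0 Zinf.
have [->|/set0P X0] := eqVneq X set0.
  apply: countable_card_lt; apply: (@card_le_inj _ _ _ _ (fun=> 0%N)) => //.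
  by move=> [|x s] [|x' s'] //=; [move=> _ [] | case | case].
have [f [fZ fi]] := card_le_fun X0 XZ.
(* Iterated pairing is injective among sequences of equal length only, so the final injection
   records the length too. *)
pose code := fix code (s : seq T) := if s is x :: s' then p (f x, code s') else z0.
have codeZ s : seq_in X s -> Z (code s).
  by elim: s => //= x s IH [Xx /IH Zs']; apply: pZ; split=> //=; exact: fZ.
have codei s s' : seq_in X s -> seq_in X s' -> size s = size s' ->
    code s = code s' -> s = s'.
  elim: s s' => [|x s IH] [|x' s'] //= [Xx Xs] [Xx' Xs'] [ss'] e.
  have Zp y t : X y -> seq_in X t -> (Z `*` Z) (f y, code t).
    by move=> Xy Xt; split=> /=; [exact: fZ|exact: codeZ].
  have [] := pi _ _ (Zp _ _ Xx Xs) (Zp _ _ Xx' Xs') e.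
  by move=> /(fi _ _ Xx Xx')-> e'; rewrite (IH s').
apply: card_lt_le (card_lt_setX (countable_card_lt (countableP [set: nat])) Zs).
apply: (@card_le_inj _ _ _ _ (fun s => (size s, code s))).
  by move=> s Xs; split=> //=; exact: codeZ.
by move=> s s' Xs Xs' [ss' cc']; exact: codei.
Qed.

End card_lt.

(** * Relations with small inner preimages *)

(** Finite subcovers are given by sequences so that [card_lt_seq] can count them. If none existed,
    the complements of the finite unions would generate a filter on [X] with a cluster point outside
    the cover. *)
Lemma compact_seq_cover (T : topologicalType) I (X : set T) (D : set I)
    (f : I -> set T) : compact X -> (forall i, D i -> open (f i)) ->
  X `<=` \bigcup_(i in D) f i ->
  exists2 s, seq_in D s & X `<=` foldr (fun i Y => f i `|` Y) set0 s.
Proof.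
move=> cX fo cov; apply: contrapT => nos.
pose u s := foldr (fun i Y => f i `|` Y) set0 s.
have u_cat s t : u (s ++ t) = u s `|` u t.
  by elim: s => [|i s IH] /=; rewrite ?set0U// IH setUA.
have in_cat s t : seq_in D s -> seq_in D t -> seq_in D (s ++ t).
  by elim: s => //= i s IH [Di Ds] Dt; split=> //; exact: IH.
pose F := [set Y : set T | exists2 s, seq_in D s & X `\` u s `<=` Y].
have FF : ProperFilter F.
  split.
    move=> [s Ds sub]; apply: nos; exists s => // x Xx.
    by apply: contrapT => nux; apply: (sub x).
  split.
  - by exists [::].
  - move=> Y Z [s Ds sY] [t Dt tZ]; exists (s ++ t); first exact: in_cat.
    rewrite u_cat => x [Xx nx].
    by split; [apply: sY|apply: tZ]; split=> // ux; apply: nx; [left|right].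
  - by move=> Y Z YZ [s Ds sY]; exists s => //; exact: subset_trans YZ.
have [|x [Xx clx]] := cX F FF; first by exists [::] => //; exact: subDsetl.
have [i Di fix_] := cov _ Xx.
have Fi : F (X `\` u [:: i]) by exists [:: i].
have [y [[Xy nfy] fy]] := clx _ _ Fi (open_nbhs_nbhs (conj (fo _ Di) fix_)).
by apply: nfy; left.
Qed.

Section relations.
Variables K L : topologicalType.
Hypotheses (hK : compact_hausdorff K) (hL : compact_hausdorff L).
Implicit Types E : set (K * L).

Definition full E := forall k, exists l, E (k, l).

Lemma closed_fiber E k : closed E -> closed [set l | E (k, l)].
Proof.
move=> cE; apply: (@preimage_closed _ _ (fun l => (k, l))) => // l _.
by apply: cvg_pair; [exact: cvg_cst|exact: cvg_id].
Qed.

Lemma closed_proj E : closed E -> closed [set k | exists l, E (k, l)].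
Proof.
move=> cE; have -> : [set k | exists l, E (k, l)] = fst @` E.
  apply/seteqP; split=> [k [l Ekl]|_ [[k l] Ekl <-]]; last by exists l.
  by exists (k, l).
apply: compact_closed; first exact: hK.2.
apply: continuous_compact.
  by apply: continuous_subspaceT => x; exact: cvg_fst.
apply: subclosed_compact cE _ (@subsetT _ _).
rewrite -setXTT; apply: compact_setX; [exact: hK.1|exact: hL.1].
Qed.

Lemma closed_cyl_snd (B : set L) : closed B -> closed [set x : K * L | B x.2].
Proof. by move=> cB; apply: (@preimage_closed _ _ snd) => // x _; exact: cvg_snd. Qed.

Lemma closed_cyl_fst (B : set K) : closed B -> closed [set x : K * L | B x.1].
Proof. by move=> cB; apply: (@preimage_closed _ _ fst) => // x _; exact: cvg_fst. Qed.

Lemma open_inner E (B : set L) : closed E -> open B ->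
  open [set k | forall l, E (k, l) -> B l].
Proof.
move=> cE oB; rewrite -closedC.
have -> : ~` [set k | forall l, E (k, l) -> B l] =
    [set k | exists l, (E `&` [set x | (~` B) x.2]) (k, l)].
  apply/seteqP; split=> [k /existsNP[l /not_implyP[Ekl nBl]]|k [l [Ekl nBl]] H].
    by exists l.
  exact: nBl (H _ Ekl).
apply: closed_proj; apply: closedI => //; apply: closed_cyl_snd.
by rewrite closedC.
Qed.

(** The fibers over [k] of the members of the chain are a filter base of nonempty closed sets. A
    cluster point, which exists by compactness of [L], lies in all of them. *)
Lemma full_bigcap_chain (C : set (set (K * L))) : C !=set0 ->
  total_on C subset -> (forall E, C E -> closed E /\ full E) ->
  full (\bigcap_(E in C) E).
Proof.
move=> [E0 CE0] Ctot CP k.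
pose F := [set X : set L | exists2 E, C E & [set l | E (k, l)] `<=` X].
have FF : ProperFilter F.
  split.
    move=> [E CE sub]; have [l El] := (CP _ CE).2 k; exact: sub El.
  split.
  - by exists E0.
  - move=> X Y [E CE EX] [E' CE' EY]; have [EE|EE] := Ctot _ _ CE CE'.
      by exists E => // l El; split; [exact: EX|exact/EY/EE].
    by exists E' => // l El; split; [exact/EX/EE|exact: EY].
  - by move=> X Y XY [E CE EX]; exists E => //; exact: subset_trans XY.
have [|l [_ ll]] := hL.1 F FF; first by exists E0.
exists l => E CE; have cl := @closed_fiber E k (CP _ CE).1.
apply: (cl l) => B nB.
by apply: ll nB; exists E.
Qed.

End relations.

Section few.
Variables (A : Type) (K : topologicalType).
Hypotheses (hA : ~ countable [set: A]) (hK : compact_hausdorff K).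
Local Notation few := (@union_of_few_closed A K).
Local Notation small X := (X #< [set: A]).

Lemma few_setU (X Y : set K) : few X -> few Y -> few (X `|` Y).
Proof.
move=> [F [Fs Fc ->]] [G [Gs Gc ->]]; exists (F `|` G); split.
- exact: card_lt_setU.
- by move=> C [/Fc|/Gc].
- by rewrite bigcup_setU.
Qed.

Lemma few_setIl (P X : set K) : closed P -> few X -> few (P `&` X).
Proof.
move=> cP [F [Fs Fc ->]]; exists [set P `&` C | C in F]; split.
- exact: card_lt_le (card_image_le _ _) Fs.
- by move=> _ [C /Fc cC <-]; exact: closedI.
- apply/seteqP; split=> [k [Pk [C FC Ck]]|k [_ [C FC <-] [Pk Ck]]].
    by exists (P `&` C) => //; exists C.
  by split => //; exists C.
Qed.

(** By compactness, finitely many clopen sets inside [Y] cover [X]. *)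
Lemma clopen_separation (X Y : set K) : clopen_basis K -> closed X -> open Y ->
  X `<=` Y -> exists P, [/\ clopen P, X `<=` P & P `<=` Y].
Proof.
move=> [_ zK] cX oY XY.
have cptX : compact X by apply: subclosed_compact cX hK.1 (@subsetT _ _).
pose D := [set U : set K | clopen U /\ U `<=` Y].
have [||s Ds Xs] := @compact_seq_cover K _ X D id cptX.
- by move=> U [[]].
- move=> x /XY Yx; have [|U [cU Ux] UY] := zK x Y; first exact: open_nbhs_nbhs.
  by exists U.
exists (foldr (fun U Z => U `|` Z) set0 s); split=> //.
  elim: s Ds {Xs} => [_|U s IH /= [[[oU cU] _] /IH[os cs]]] /=.
    by split; [exact: open0|exact: closed0].
  by split; [exact: openU|exact: closedU].
by elim: s Ds {Xs} => [_ x []|U s IH /= [[_ UY] /IH sY]]; rewrite subUset.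
Qed.

Lemma F_space_clopen (U V : set K) : clopen_basis K -> F_space A K ->
  open U -> open V -> few U -> few V -> U `&` V = set0 ->
  exists P, [/\ clopen P, U `<=` P & P `&` V = set0].
Proof.
move=> zK FK oU oV fU fV UV0.
have cl0 := FK _ _ oU oV fU fV UV0.
have [|||P [cP UP PV]] := @clopen_separation (closure U) (~` closure V) zK.
- exact: closed_closure.
- by rewrite openC; exact: closed_closure.
- by move=> x Ux Vx; have : set0 x by rewrite -cl0.
exists P; split => //; first exact: subset_trans (@subset_closure _ _) UP.
apply/seteqP; split=> // x [/PV nV Vx]; exact/nV/subset_closure.
Qed.

End few.


(** * Shrinking closed relations to graphs *)

Section lifting.
Variables (R : realType) (A : Type) (K L : topologicalType).
Hypotheses (hA : ~ countable [set: A]).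
Hypotheses (hK : compact_hausdorff K) (hL : compact_hausdorff L).
Hypotheses (zK : clopen_basis K) (FK : F_space A K).
Implicit Types E : set (K * L).

Definition few_inner E := forall B : set L, open B ->
  union_of_few_closed A [set k | forall l, E (k, l) -> B l].

(** A clopen [P] contains every [k] whose fiber lies in [B] and no [k] whose fiber lies in [C].
    Removing [C] over [P] and [B] elsewhere therefore empties no fiber. *)
Lemma decide E (B C : set L) : closed E -> full E -> few_inner E ->
  open B -> open C -> B `&` C = set0 ->
  exists E', [/\ E' `<=` E, closed E', full E', few_inner E' &
    forall k, (forall l, E' (k, l) -> ~ B l) \/ (forall l, E' (k, l) -> ~ C l)].
Proof.
move=> cE fE sE oB oC BC0.
have [|P [[oP cP] BP PC]] := F_space_clopen hK zK FK
    (open_inner hK hL cE oB) (open_inner hK hL cE oC) (sE _ oB) (sE _ oC).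
  apply/seteqP; split=> // k [Bk Ck]; have [l Ekl] := fE k.
  by have : set0 l by rewrite -BC0; split; [exact: Bk|exact: Ck].
exists (E `&` [set x | P x.1 /\ ~ C x.2 \/ ~ P x.1 /\ ~ B x.2]); split.
- exact: subIsetl.
- apply: closedI => //; apply: (@closedU _ [set x | P x.1 /\ ~ C x.2]).
    apply: (@closedI _ [set x : K * L | P x.1] [set x | (~` C) x.2]).
      exact: closed_cyl_fst.
    by apply: closed_cyl_snd; rewrite closedC.
  apply: (@closedI _ [set x : K * L | (~` P) x.1] [set x | (~` B) x.2]).
    by apply: closed_cyl_fst; rewrite closedC.
  by apply: closed_cyl_snd; rewrite closedC.
- move=> k; have [Pk|nPk] := pselect (P k).
    have : ~ (forall l, E (k, l) -> C l).
      by move=> Ck; have : set0 k by rewrite -PC.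
    by move=> /existsNP[l /not_implyP[Ekl nCl]]; exists l; split=> //; left.
  have : ~ (forall l, E (k, l) -> B l) by move=> /BP.
  by move=> /existsNP[l /not_implyP[Ekl nBl]]; exists l; split=> //; right.
- move=> D oD.
  (* Over [P] the cut fiber lies in [D] exactly when the old one lies in the union of [C] and [D];
     off [P] the same holds with [B]. Smallness is thus inherited from [E]. *)
  have -> : [set k | forall l, (E `&` [set x | P x.1 /\ ~ C x.2 \/
       ~ P x.1 /\ ~ B x.2]) (k, l) -> D l] =
     (P `&` [set k | forall l, E (k, l) -> (C `|` D) l]) `|`
     (~` P `&` [set k | forall l, E (k, l) -> (B `|` D) l]).
    apply/seteqP; split=> [k H|k [[Pk H] l [Ekl [[_ nC]|[//]]]|
                               [nPk H] l [Ekl [[//]|[_ nB]]]]].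
    + have [Pk|nPk] := pselect (P k); [left|right]; split=> // l Ekl.
        have [Cl|nCl] := pselect (C l); [by left|right].
        by apply: H; split=> //; left.
      have [Bl|nBl] := pselect (B l); [by left|right].
      by apply: H; split=> //; right.
    + by case: (H _ Ekl).
    + by case: (H _ Ekl).
  apply: few_setU => //; apply: few_setIl => //; try by [rewrite closedC|
    apply: sE; exact: openU].
- move=> k; have [Pk|nPk] := pselect (P k); [right|left];
  by move=> l [_ [[]|[]]].
Qed.

Lemma continuous_selection E (h : L -> R) :
  closed E -> full E -> few_inner E -> continuous h ->
  exists2 v : K -> R, continuous v & forall k, exists2 l, E (k, l) & h l = v k.
Proof.
move=> cE fE sE ch.
pose ok E := [/\ closed E, full E & few_inner E].
(* The condition [ok E0] is placed under the existential so that choice gives a total function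
   [next]. *)
have step (q : rat) E0 : exists E', ok E0 -> [/\ E' `<=` E0, ok E' & forall k,
    (forall l, E' (k, l) -> ~ (h l < ratr q)%R) \/
    (forall l, E' (k, l) -> ~ (ratr q < h l)%R)].
  have [[c0 f0 s0]|nok] := pselect (ok E0); last by exists E0.
  have [|||E' [sub c' f' s' dec]] := @decide E0 [set l | (h l < ratr q)%R]
      [set l | (ratr q < h l)%R] c0 f0 s0.
  - by apply: (@open_comp _ _ h [set x | (x < ratr q)%R]) => //; exact: open_lt.
  - by apply: (@open_comp _ _ h [set x | (ratr q < x)%R]) => //; exact: open_gt.
  - apply/seteqP; split=> // l [/= lt1 lt2].
    by have := lt_trans lt1 lt2; rewrite ltxx.
  by exists E'.
pose q n : rat := odflt 0%R (unpickle n).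
have /choice[next nextP] : forall p : nat * set (K * L), exists E', ok p.2 ->
    [/\ E' `<=` p.2, ok E' & forall k,
    (forall l, E' (k, l) -> ~ (h l < ratr (q p.1))%R) \/
    (forall l, E' (k, l) -> ~ (ratr (q p.1) < h l)%R)].
  by move=> [n E0]; exact: step.
pose F := fix F n := if n is m.+1 then next (m, F m) else E.
have Fok n : ok (F n) by elim: n => [//|n IH] /=; have [] := nextP (n, F n) IH.
have Fsub n : F n.+1 `<=` F n by have [] := nextP (n, F n) (Fok n).
have Fmono m n : (m <= n)%N -> F n `<=` F m.
  move=> /subnK <-; elim: (n - m)%N => // d IH; exact: subset_trans (Fsub _) IH.
pose F' := \bigcap_(G in range F) G.
have cF' : closed F' by apply: closed_bigI => G [n _ <-]; have [] := Fok n.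
have fF' : full F'.
  apply: full_bigcap_chain => //; first by exists E; exists 0%N.
    move=> _ _ [n _ <-] [m _ <-].
    by have [nm|/ltnW mn] := leqP n m; [right|left]; exact: Fmono.
  by move=> _ [n _ <-]; have [] := Fok n.
(* If [h] took two values on a fiber, a rational [r] between them would occur as some [q n], and
   stage [n.+1] has discarded one of the two sides of [r]. *)
have lt k l l' : F' (k, l) -> F' (k, l') -> ~ (h l < h l')%R.
  move=> Fl Fl' /rat_in_itvoo[r]; rewrite in_itv /= => /andP[lr rl'].
  pose n := pickle r; have qn : q n = r by rewrite /q pickleK.
  have [_ _ /(_ k)[H|H]] := nextP (n, F n) (Fok n).
    by apply: (H l); [apply: Fl; exists n.+1|rewrite /= qn].
  by apply: (H l'); [apply: Fl'; exists n.+1|rewrite /= qn].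
have eqh k l l' : F' (k, l) -> F' (k, l') -> h l = h l'.
  move=> Fl Fl'; have [ll|ll|//] := ltgtP (h l) (h l').
    by have := lt _ _ _ Fl Fl' ll.
  by have := lt _ _ _ Fl' Fl ll.
have /choice[s sP] := fF'; exists (h \o s); last first.
  by move=> k; exists (s k) => //; apply: (sP k); exists 0%N.
apply/continuous_closedP => D cD.
(* As [h] is constant on the fibers of [F'], the preimage does not depend on the choice [s] and is
   the projection of a closed set. *)
have -> : (h \o s) @^-1` D =
    [set k | exists l, (F' `&` [set x | (h @^-1` D) x.2]) (k, l)].
  apply/seteqP; split=> [k Dk|k [l [Fl Dl]]]; first by exists (s k).
  by rewrite /= (eqh k _ l).
apply: (closed_proj hK hL); apply: closedI => //; apply: closed_cyl_snd.
by move/continuous_closedP : ch; exact.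
Qed.

(** * Transfinite iteration by Zorn's lemma *)

Section transfinite.
Variables (I : Type) (le : I -> I -> Prop) (h : I -> L -> R) (E0 : set (K * L)).
Hypotheses (ch : forall i, continuous (h i)) (cE0 : closed E0) (fE0 : full E0).
Hypotheses (le_refl : forall i, le i i)
  (le_min : forall X : set I, X !=set0 ->
    exists2 i, X i & forall j, le j i -> X j -> j = i).

Definition fiber_const E i := forall k l l', E (k, l) -> E (k, l') -> h i l = h i l'.

(** Whole initial segments are required, so that a single index at which [E] is not constant on
    fibers bounds all of [settled E]. *)
Definition settled E := [set i | forall j, le j i -> fiber_const E j].

(* [E] encodes a lift of [K] to the quotient of [L] by the functions [h j]
   for [j] in the initial segment [settled E]. *)
Definition partial_lift E := [/\ closed E, full E, E `<=` E0 &
  forall k l, E0 (k, l) ->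
    (forall j, settled E j -> exists2 l', E (k, l') & h j l = h j l') -> E (k, l)].

Lemma settled_sub E E' : E' `<=` E -> settled E `<=` settled E'.
Proof.
by move=> sub i Si j /Si cj k l l' El El'; apply: (cj k); exact: sub.
Qed.

Lemma partial_lift_bigcap (C : set (set (K * L))) : C !=set0 ->
  C `<=` partial_lift -> total_on C subset -> partial_lift (\bigcap_(E in C) E).
Proof.
move=> C0 CP Ctot; split.
- by apply: closed_bigI => E /CP[].
- by apply: full_bigcap_chain => // E /CP[].
- by have [E CE] := C0; move=> x /(_ _ CE); have [_ _ + _] := CP _ CE; apply.
- move=> k l E0l H E CE; have [_ _ _ HE] := CP _ CE; apply: HE => // j Sj.
  have [|l' El' hl'] := H j; first by apply: settled_sub Sj => x; exact.
  by exists l' => //; exact: El'.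
Qed.

(** [E] is cut only by the equation [h i l = v k], not replaced by the smaller relation from which
    [v] was obtained: the cut keeps every point of [E0] that agrees with its fiber on the settled
    functions, as the last clause of [partial_lift] demands. *)
Lemma partial_lift_step E i : partial_lift E -> few_inner E ->
  (forall j, le j i -> j <> i -> settled E j) ->
  exists E', [/\ partial_lift E', E' `<=` E & settled E' i].
Proof.
move=> [cE fE EE0 sat] sE Sj.
have [v cv vP] := continuous_selection cE fE sE (@ch i).
pose E' := E `&` [set x | h i x.2 = v x.1].
have E'E : E' `<=` E by exact: subIsetl.
have Si : settled E' i.
  move=> j ji; have [->|neq] := pselect (j = i).
    by move=> k l l' [_ /= e] [_ /= e']; rewrite e e'.
  exact: settled_sub (Sj j ji neq) _ (le_refl j).
exists E'; split=> //; split.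
- apply: closedI => //.
  have -> : [set x | h i x.2 = v x.1] =
      (fun x : K * L => (h i x.2 - v x.1)%R) @^-1` [set 0%R].
    apply/seteqP; split=> x /= => [->|/eqP]; first by rewrite subrr.
    by rewrite subr_eq0 => /eqP.
  apply: preimage_closed => [x _|]; last exact: closed_eq.
  apply: (@continuousB _ _ _ (fun x : K * L => h i x.2) (fun x => v x.1)).
    by apply: (@continuous_comp _ _ _ snd); [exact: cvg_snd|exact: ch].
  by apply: (@continuous_comp _ _ _ fst); [exact: cvg_fst|exact: cv].
- by move=> k; have [l El hl] := vP k; exists l; split.
- exact: subset_trans EE0.
- move=> k l E0l H; split.
    apply: sat => // j Sj'.
    have [|l' [El' _] hl'] := H j; first exact: settled_sub Sj'.
    by exists l'.
  by have [l' [_ /= e] e'] := H i Si; rewrite /= e' e.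
Qed.

(** A minimal partial lift has no unsettled index, since [partial_lift_step] at a minimal one would
    shrink it. Smallness is not carried through intersections of chains; it is recovered from the
    form of a partial lift, and only while some index is unsettled, which is when the settled
    segment is known to be small. *)
Lemma ex_partial_lift :
  (forall E, partial_lift E -> (exists i, ~ settled E i) -> few_inner E) ->
  exists2 E, partial_lift E & forall i, settled E i.
Proof.
move=> H.
pose r (x y : {E | partial_lift E}) := `[< sval y `<=` sval x >].
have E0P : partial_lift E0 by split.
have [||| |[E PE] Emin] := @Zorn _ r.
- by move=> x; apply/asboolP.
- by move=> x y z /asboolP yx /asboolP zy; apply/asboolP; exact: subset_trans yx.
- move=> [x Px] [y Py] /asboolP yx /asboolP xy; apply/eq_exist.
  exact/seteqP.
- move=> X Xtot; have [X0|nX0] := pselect (X !=set0); last first.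
    by exists (exist _ E0 E0P) => x Xx; case: nX0; exists x.
  have P : partial_lift (\bigcap_(E in sval @` X) E).
    apply: partial_lift_bigcap.
    - by have [x Xx] := X0; exists (sval x); exists x.
    - by move=> _ [[x Px] _ <-].
    - move=> _ _ [x Xx <-] [y Xy <-].
      by have [/asboolP|/asboolP] := Xtot _ _ Xx Xy; [right|left].
  exists (exist _ _ P) => x Xx; apply/asboolP => p /=; apply; by exists x.
exists E => //; apply: contrapT => /existsNP[i0 nSi0].
have [i nSi imin] := le_min (ex_intro (~` settled E) i0 nSi0).
have [|j ji jneq|E' [PE' E'E Si]] := partial_lift_step (i := i) PE.
- by apply: H => //; exists i.
- by apply: contrapT => nSj; apply: jneq; exact: imin.
have /(congr1 sval)/= E'eq : exist _ E' PE' = exist _ E PE.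
  by apply: Emin; exact/asboolP.
by apply: nSi; rewrite -E'eq.
Qed.

End transfinite.

Lemma lift_of_graph E (f : K -> L -> Prop) : closed E -> full E ->
  (forall k l l', E (k, l) -> E (k, l') -> l = l') ->
  (forall k l, E (k, l) -> f k l) ->
  exists2 g : K -> L, continuous g & forall k, f k (g k).
Proof.
move=> cE /choice[g gP] inj Ef; exists g => [|k]; last exact: Ef.
apply/continuous_closedP => D cD.
have -> : g @^-1` D = [set k | exists l, (E `&` [set x | D x.2]) (k, l)].
  apply/seteqP; split=> [k Dk|k [l [El Dl]]]; first by exists (g k).
  by rewrite /= (inj k (g k) l).
by apply: (closed_proj hK hL); apply: closedI => //; exact: closed_cyl_snd.
Qed.

End lifting.

(** * Orders and separating functions *)

Lemma ex_well_order (T : Type) : exists le : T -> T -> Prop,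
  [/\ forall x, le x x, forall x y, le x y -> le y x -> x = y &
      forall X : set T, X !=set0 -> exists2 z, X z & forall x, X x -> le z x].
Proof.
have [R woR] := well_ordering_principle {classic T}.
have min (X : set T) : X !=set0 -> exists2 z, X z & forall x, X x -> R z x.
  move=> [x0 Xx0].
  have [|z [[Xz Rz] _]] := woR (fun x : {classic T} => `[< X x >]).
    by exists x0; apply/asboolP.
  by exists z; [exact/asboolP|move=> x /asboolP; exact: Rz].
have anti x y : R x y -> R y x -> x = y.
  move=> xy yx; have wo : wo_chain R predT by move=> X _; exact: woR.
  by apply: (wo_chain_antisymmetric wo) => //; rewrite xy.
exists R; split=> // x.
by have [|z -> Rz] := min [set x]; [exists x|exact: Rz].
Qed.

(* Of the elements whose initial segment is as large as [A], the least one has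
   an initial segment of the wanted order type: pull it back to [A]. *)
Lemma ex_initial_order (A : Type) : exists le : A -> A -> Prop,
  [/\ forall x, le x x, forall x y, le x y -> le y x -> x = y,
      forall X : set A, X !=set0 -> exists2 z, X z & forall x, X x -> le z x &
      forall a, [set x | ~ le a x] #< [set: A]].
Proof.
have [le [refl anti min]] := ex_well_order A.
have tot x y : ~ le x y -> le y x /\ y <> x.
  move=> nxy; split; last by move=> e; apply: nxy; rewrite e.
  have [|z [->|->] zP] := min [set x; y]; first by exists x; left.
    by case: nxy; apply: zP; right.
  by apply: zP; left.
pose W := [set a | [set: A] #<= [set x | ~ le a x]].
have [W0|nW0] := pselect (W !=set0); last first.
  exists le; split=> // a; apply/card_ltP => Aa; apply: nW0; by exists a.
have [a0 Wa0 a0P] := min _ W0.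
have [|j [js ji]] := card_le_fun _ Wa0; first by exists a0.
exists (fun x y => le (j x) (j y)); split=> //.
- by move=> x y xy yx; apply: ji => //; exact: anti.
- move=> X [x Xx]; have [|_ [z Xz <-] zP] := min (j @` X).
    by exists (j x); exists x.
  by exists z => // y Xy; apply: zP; exists y.
(* The point [j a] strictly precedes [a0], the least point with a large initial segment. *)
- move=> a; have : [set x | ~ le (j a) x] #< [set: A].
    by apply/card_ltP => Ws; exact: (js a I) (a0P _ Ws).
  apply: card_lt_le; apply: (@card_le_inj _ _ _ _ j) => // x y _ _.
  exact: ji.
Qed.

Section compact_hausdorff_spaces.
Variable (R : realType) (L : topologicalType).
Hypothesis hL : compact_hausdorff L.

Lemma basis_regular (B : set (set L)) (x : L) (W : set L) : basis B -> nbhs x W ->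
  exists2 U, B U & U x /\ closure U `<=` W.
Proof.
move=> [_ bB] Wx.
have [V Vx VW] := compact_regular hL.2 hL.1 (@filterT _ (nbhs x) _) Wx.
have [U [BU Ux] UV] := bB x _ Vx.
by exists U => //; split=> //; apply: subset_trans (closureS UV) VW.
Qed.

Lemma urysohn_function (X Y : set L) : closed X -> closed Y -> X `&` Y = set0 ->
  exists h : L -> R, [/\ continuous h, forall x, X x -> h x = 0%R &
    forall y, Y y -> h y = 1%R].
Proof.
move=> cX cY XY0.
have sep : uniform_separator X Y.
  move: X Y cX cY XY0; apply/(@normal_separatorP R).
  by apply: compact_normal hL.2 hL.1.
have /(@uniform_separatorP _ R)[h [ch _ hX hY]] := sep.
by exists h; split=> // x Xx; [apply: hX|apply: hY]; exists x.
Qed.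

Lemma closed_point (x : L) : closed [set x].
Proof. exact/accessible_closed_set1/hausdorff_accessible/hL.2. Qed.

Lemma ex_separating_function (x y : L) : x <> y ->
  exists2 h : L -> R, continuous h & h x <> h y.
Proof.
move=> xy; have [|||h [ch h0 h1]] :=
    @urysohn_function [set x] [set y].
- exact: closed_point.
- exact: closed_point.
- by apply/seteqP; split=> // z [/= -> /xy].
by exists h => //; rewrite h0// h1//; apply/eqP; rewrite eq_sym oner_eq0.
Qed.

(** By regularity, an open set is the union of the closures of those base elements whose closure it
    contains. *)
Lemma HL_weight (A : Type) : weight L #< [set: A] -> HL A L.
Proof.
have [bL _] := weightP L => wL U oU.
exists (closure @` [set B | weight L B /\ closure B `<=` U]); split.
- apply: card_lt_le (card_image_le _ _) _.
  by apply: card_lt_le wL; apply: subset_card_le => B [].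
- by move=> _ [B _ <-]; exact: closed_closure.
- apply/seteqP; split=> [x Ux|x [_ [B [_ BU] <-] /BU]] //.
  have [|B wB [Bx BU]] := @basis_regular _ x U bL; first exact: open_nbhs_nbhs.
  by exists (closure B); [exists B|exact: subset_closure].
Qed.

(** Pairs of base elements are coded by [A], and each pair with disjoint closures gets a Urysohn
    function. An index coding no such pair gets the constant [0]. *)
Lemma separating_family (A : Type) : infinite_set [set: A] ->
  weight L #<= [set: A] -> exists h : A -> L -> R,
    (forall a, continuous (h a)) /\
    (forall x y, (forall a, h a x = h a y) -> x = y).
Proof.
have [bL _] := weightP L => Ainf wL.
have /card_le_relP[r [rA ri]] : weight L `*` weight L #<= [set: A].
  apply: card_le_trans (card_le_setX wL wL) _.
  exact: card_le_trans (card_setX_infinite Ainf) (card_lexx _).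
have /choice[h hP] : forall a, exists g : L -> R, continuous g /\ forall B B',
    weight L B -> weight L B' -> r (B, B') a -> closure B `&` closure B' = set0 ->
    forall x y, B x -> B' y -> g x <> g y.
  move=> a; have [[B [B' [wB wB' rB cl0]]]|nB] := pselect (exists B B',
      [/\ weight L B, weight L B', r (B, B') a & closure B `&` closure B' = set0]).
    have [||//|g [cg g0 g1]] := @urysohn_function (closure B) (closure B').
    - exact: closed_closure.
    - exact: closed_closure.
    exists g; split=> // C C' wC wC' rC _ x y Cx Cy.
    have [? ?] : (C, C') = (B, B') by apply: (ri _ _ a).
    subst C C'; rewrite g0; last exact: subset_closure.
    rewrite g1; last exact: subset_closure.
    by apply/eqP; rewrite eq_sym oner_eq0.
  exists (fun=> 0%R); split; first by move=> x; exact: cvg_cst.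
  by move=> B B' wB wB' rB cl0; case: nB; exists B, B'.
exists h; split=> [a|x y hxy]; first by have [] := hP a.
apply: contrapT => xy.
have [|B wB [Bx By]] := @basis_regular _ x (~` [set y]) bL.
  apply: open_nbhs_nbhs; split; last by [].
  by rewrite openC; exact: closed_point.
have [|B' wB' [B'y B'B]] := @basis_regular _ y (~` closure B) bL.
  apply: open_nbhs_nbhs; split; first by rewrite openC; exact: closed_closure.
  by move=> /By /=.
have [a _ ra] := rA (B, B') (conj wB wB').
have [_ /(_ B B' wB wB' ra) neq] := hP a.
apply: neq (hxy a) => //.
by apply/seteqP; split=> // z [Bz /B'B].
Qed.

End compact_hausdorff_spaces.

(** * Existence of lifts *)

Lemma few_bigcup (A I : Type) (K : topologicalType) (D : set I) (f : I -> set K) :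
  D #< [set: A] -> (forall i, D i -> closed (f i)) ->
  union_of_few_closed A (\bigcup_(i in D) f i).
Proof.
move=> Ds fc; exists (f @` D); split.
- exact: card_lt_le (card_image_le _ _) Ds.
- by move=> _ [i Di <-]; exact: fc.
- by rewrite bigcup_image.
Qed.

Section few_inner.
Variables (A : Type) (K L : topologicalType).
Hypotheses (hA : ~ countable [set: A]).
Hypotheses (hK : compact_hausdorff K) (hL : compact_hausdorff L).
Variable E : set (K * L).
Hypotheses (cE : closed E) (fE : full E).

(** The first hypothesis makes fibers of [E] equal or disjoint. So [O] consists of the points whose
    fiber meets the complement of [Z], the closed union of the fibers over the complement of [O];
    that complement is a union of few closed sets, which pull back to closed sets of [K]. *)
Lemma few_inner_HL :
  (forall k k' l l', E (k, l) -> E (k', l) -> E (k, l') -> E (k', l')) ->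
  HL A L -> few_inner A E.
Proof.
move=> classE HLL B oB.
set O := [set k | _].
pose Z := [set l | exists k, (E `&` [set x | (~` O) x.1]) (k, l)].
have cZ : closed Z.
  pose E' := [set x : L * K | (E `&` [set x | (~` O) x.1]) (x.2, x.1)].
  apply: (@closed_proj _ _ hL hK E').
  apply: (@preimage_closed _ _ (fun x : L * K => (x.2, x.1))) => [x _|].
    by apply: cvg_pair; [exact: cvg_snd|exact: cvg_fst].
  apply: closedI => //; apply: closed_cyl_fst; rewrite closedC.
  exact: open_inner.
have [|F [Fs Fc ZF]] := HLL (~` Z); first by rewrite openC.
have -> : O = \bigcup_(C in F) [set k | exists l, (E `&` [set x | C x.2]) (k, l)].
  apply/seteqP; split=> [k Ok|k [C FC [l [/= Ekl Cl]]]].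
    have [l Ekl] := fE k.
    have : (~` Z) l.
      move=> [k' [/= Ek'l nOk']]; apply: nOk' => l' Ek'l'; apply: Ok.
      exact: classE Ek'l Ekl Ek'l'.
    by rewrite ZF => -[C FC Cl]; exists C => //; exists l.
  apply: contrapT => nOk; have : (~` Z) l by rewrite ZF; exists C.
  by move=> nZ; apply: nZ; exists k.
apply: few_bigcup => // C FC; apply: (closed_proj hK hL); apply: closedI => //.
by apply: (@closed_cyl_snd K L C); exact: Fc.
Qed.

(** [S] plays the role of a small family of closed sets separating the points of the quotient. If
    the fiber of [k] lies in [B], compactness gives finitely many members of [S] that contain this
    fiber and have intersection inside [B]. Hence [O] is a union of closed sets [Z s] indexed by
    finite sequences in [S]. *)
Lemma few_inner_family (S : set (set L)) : S #< [set: A] -> S `<=` closed ->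
  (forall C k l l', S C -> E (k, l) -> E (k, l') -> C l -> C l') ->
  (forall k l, (forall C, S C -> (exists2 l', E (k, l') & C l') -> C l) -> E (k, l)) ->
  few_inner A E.
Proof.
move=> Ss Sc Ssat SE B oB.
set O := [set k | _].
pose J s : set L := foldr (fun C Y => C `&` Y) setT s.
pose Z s := [set k | exists l, (E `&` [set x | J s x.2]) (k, l)].
have Jsat s k l l' : seq_in S s -> E (k, l) -> E (k, l') -> J s l -> J s l'.
  move=> + El El'; elim: s => //= C s IH [SC Ds] [Cl Jl].
  by split; [exact: (Ssat C k l)|exact: IH].
have cJ s : seq_in S s -> closed (J s).
  elim: s => [_|C s IH [SC Ds]]; first exact: closedT.
  by apply: closedI; [exact: Sc|exact: IH].
have -> : O = \bigcup_(s in [set s | seq_in S s /\ Z s `<=` O]) Z s; last first.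
  apply: few_bigcup => [|s [Ds _]].
    apply: card_lt_le (card_lt_seq hA Ss); apply: subset_card_le => s [].
    by [].
  apply: (closed_proj hK hL); apply: closedI => //.
  by apply: (@closed_cyl_snd K L (J s)); exact: cJ.
apply/seteqP; split=> [k Ok|k [s [_ ZO] /ZO]//].
pose D := [set C | S C /\ exists2 l, E (k, l) & C l].
have cB : compact (~` B).
  by apply: subclosed_compact hL.1 (@subsetT _ _); rewrite closedC.
have [||s Ds Bs] := @compact_seq_cover L _ (~` B) D (fun C => ~` C) cB.
- by move=> C [SC _]; rewrite openC; exact: Sc.
- move=> l nBl; have : ~ E (k, l) by move=> /Ok.
  apply: contra_notP => nD; apply: SE => C SC El; apply: contrapT => nCl.
  by apply: nD; exists C.
have SDs : seq_in S s /\ forall l, E (k, l) -> J s l.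
  elim: s Ds {Bs} => //= C s IH [[SC [l0 El0 Cl0]] /IH[Ss' Js]]; split=> // l El.
  by split; [exact: (Ssat C k l0)|exact: Js].
have JB : J s `<=` B.
  move=> l Jl; apply: contrapT => /Bs; elim: s Jl {Ds Bs SDs} => //= C s IH [Cl Jl].
  by move=> [/=|]; last exact: IH.
have [l Ekl] := fE k; exists s; last by exists l; split=> //; exact: SDs.2.
split; first exact: SDs.1.
move=> k' [l' [/= El' Jl']] m Em; apply: JB; exact: (Jsat _ _ _ _ SDs.1 El' Em Jl').
Qed.

End few_inner.

Section sufficiency.
Variables (R : realType) (A : Type) (K : topologicalType).
Hypotheses (hA : ~ countable [set: A]).
Hypotheses (hK : compact_hausdorff K) (zK : clopen_basis K) (FK : F_space A K).

Section lift.
Variables (L M : topologicalType) (p : L -> M) (f : K -> M).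
Hypotheses (pP : compact_surjection p) (cf : continuous f).

Definition pullback := [set x : K * L | f x.1 = p x.2].

Lemma closed_pullback : closed pullback.
Proof.
have [_ [_ hM] cp _] := pP.
have -> : pullback = (fun x : K * L => (f x.1, p x.2)) @^-1` [set y : M * M | y.1 = y.2].
  by [].
apply: preimage_closed => [x _|].
  apply: cvg_pair; apply: continuous_comp; try exact: cf; try exact: cp.
    exact: cvg_fst.
  exact: cvg_snd.
move=> [y z] cl; apply: hM => B C nB nC.
have [[u v] [/= uv [Bu Cv]]] : [set y : M * M | y.1 = y.2] `&` (B `*` C) !=set0.
  by apply: cl; exists (B, C).
by exists u; split=> //; rewrite uv.
Qed.

Lemma full_pullback : full pullback.
Proof.
by have [_ _ _ surj] := pP; move=> k; have [l _ pl] := surj (f k) I; exists l.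
Qed.

Lemma lift_family I (le : I -> I -> Prop) (h : I -> L -> R) :
  (forall i, continuous (h i)) -> (forall x y, (forall i, h i x = h i y) -> x = y) ->
  (forall i, le i i) ->
  (forall X : set I, X !=set0 ->
    exists2 i, X i & forall j, le j i -> X j -> j = i) ->
  (forall E, partial_lift le h pullback E -> (exists i, ~ settled le h E i) ->
    few_inner A E) ->
  exists2 g : K -> L, continuous g & p \o g = f.
Proof.
move=> ch sep refl min few; have [hL _ _ _] := pP.
have [E [cE fE EP _] Eall] :=
  ex_partial_lift hA hK hL zK FK ch closed_pullback full_pullback refl min few.
have [|k l /EP|g cg fg] := @lift_of_graph _ _ hK hL E (fun k l => f k = p l) cE fE.
- by move=> k l l' El El'; apply: sep => i; exact: (Eall i i (refl i) k).
- by [].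
by exists g => //; apply/funext => k /=; rewrite fg.
Qed.

Lemma lift_HL : HL A L -> exists2 g : K -> L, continuous g & p \o g = f.
Proof.
move=> HLL; have [hL _ _ _] := pP.
(* All continuous functions are used. Ordered by equality, every index is minimal, since no
   enumeration has to be kept short in this case. *)
apply: (@lift_family {h : L -> R | continuous h} eq (fun i => sval i)) => //.
- by case.
- move=> x y hxy; apply: contrapT => xy.
  by have [h ch] := ex_separating_function R hL xy; apply; exact: (hxy (exist _ h ch)).
- by move=> X [i Xi]; exists i.
(* Fibers sharing a point have the same image in [M] and the same values of all settled functions,
   so saturation makes them equal. *)
move=> E [cE fE EP sat] _; apply: few_inner_HL => // k k' l l' El E'l El'.
apply: sat => [|j Sj].
  by rewrite /pullback /= -(EP _ El') /= (EP _ El) (EP _ E'l).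
by exists l => //; exact: (Sj j erefl k).
Qed.

Lemma lift_weight : weight M #< [set: A] -> weight L #<= [set: A] ->
  exists2 g : K -> L, continuous g & p \o g = f.
Proof.
move=> wM wL; have [hL hM cp _] := pP.
have Ainf : infinite_set [set: A] by move=> /finite_set_countable.
have [h [ch sep]] := separating_family R hL Ainf wL.
have [le [refl anti min seg]] := ex_initial_order A.
apply: (@lift_family A le h) => //.
  move=> X /min[z Xz zP]; exists z => // j jz Xj; apply: anti => //; exact: zP.
move=> E [cE fE EP sat] [i0 /existsNP[j0 /not_implyP[_ nj0]]].
(* No settled index has the unsettled [j0] below it, and the segment below [j0] is small. *)
have Ss : settled le h E #< [set: A].
  apply: card_lt_le (seg j0); apply: subset_card_le => j Sj j0j; exact/nj0/Sj.
(* These closed sets separate points with different images in [M], and points at which some settled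
   function differs, by rational half-lines. *)
pose SM := [set p @^-1` (closure N) | N in weight M].
pose g (t : A * (rat * bool)) : set L :=
  if t.2.2 then [set l | (h t.1 l <= ratr t.2.1)%R]
  else [set l | (ratr t.2.1 <= h t.1 l)%R].
have [bM _] := weightP M.
apply: (@few_inner_family _ _ _ hA hK hL E cE fE
    (SM `|` g @` (settled le h E `*` [set: rat * bool]))).
- apply: (card_lt_setU hA).
    exact: card_lt_le (card_image_le _ _) wM.
  apply: card_lt_le (card_image_le _ _) _; apply: (card_lt_setX hA Ss).
  exact: countable_card_lt.
- move=> _ [[N _ <-]|[[a [q b]] _ <-]].
    by apply: (@preimage_closed _ _ p) => //; exact: closed_closure.
  rewrite /g; case: b => /=.
    by apply: (@preimage_closed _ _ (h a) [set x | (x <= ratr q)%R]) => //; exact: closed_le.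
  by apply: (@preimage_closed _ _ (h a) [set x | (ratr q <= x)%R]) => //; exact: closed_ge.
- move=> _ k l l' [[N _ <-]|[[a [q b]] [Sa _] <-]] El El'.
    by rewrite /preimage /= -(EP _ El) -(EP _ El').
  have /= hll' := Sa a (refl a) k l l' El El'.
  by rewrite /g /=; case: (b); rewrite /= hll'.
(* By saturation it suffices that [f k = p l] and that [l] agrees with a point [l0] of the fiber on
   the settled functions; a failure of either is witnessed by a set of the family that meets the
   fiber and misses [l]. *)
move=> k l H; have [l0 El0] := fE k.
apply: sat => [|j Sj].
  apply: contrapT => /= neq.
  have [|N wN [Nf Np]] := @basis_regular _ hM _ (f k) (~` [set p l]) bM.
    apply: open_nbhs_nbhs; split; last exact: neq.
    by rewrite openC; exact: closed_point.
  have : (p @^-1` closure N) l.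
    apply: H; first by left; exists N.
    by exists l0 => //=; rewrite -(EP _ El0); exact: subset_closure.
  by move=> /Np nl; exact: nl.
exists l0 => //; have [lt|lt|//] := ltgtP (h j l) (h j l0).
  have [q] := rat_in_itvoo lt; rewrite in_itv /= => /andP[lq qr].
  have : g (j, (q, false)) l.
    apply: H; first by right; exists (j, (q, false)).
    by exists l0 => //=; exact: ltW.
  by rewrite /g /= leNgt lq.
have [q] := rat_in_itvoo lt; rewrite in_itv /= => /andP[lq qr].
have : g (j, (q, true)) l.
  apply: H; first by right; exists (j, (q, true)).
  by exists l0 => //=; exact: ltW.
by rewrite /g /= leNgt qr.
Qed.

End lift.
End sufficiency.

(** * Consequences of projectivity *)

Lemma cluster_nbhs_continuous (X Y : topologicalType) (f : X -> Y) x y :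
  continuous f -> cluster (nbhs x) y -> cluster (nbhs (f x)) (f y).
Proof.
move=> cf cl B C nB nC.
by have [z [Bz Cz]] := cl _ _ (cf _ _ nB) (cf _ _ nC); exists (f z).
Qed.

Lemma hausdorff_inj (X Y : topologicalType) (f : X -> Y) : continuous f ->
  injective f -> hausdorff_space Y -> hausdorff_space X.
Proof.
by move=> cf fi hY x y /(cluster_nbhs_continuous cf)/hY/fi.
Qed.

Lemma hausdorff_prod (X Y : topologicalType) :
  hausdorff_space X -> hausdorff_space Y -> hausdorff_space (X * Y)%type.
Proof.
move=> hX hY [x y] [x' y'] cl.
have /hX/= -> : cluster (nbhs (x, y).1) (x', y').1.
  by apply: cluster_nbhs_continuous cl => z; exact: cvg_fst.
have /hY/= -> // : cluster (nbhs (x, y).2) (x', y').2.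
by apply: cluster_nbhs_continuous cl => z; exact: cvg_snd.
Qed.

Lemma compact_subtype (X : topologicalType) (D : set X) : compact D ->
  compact [set: D].
Proof.
move=> cD F FF _.
have [|x [Dx clx]] := cD (set_val @ F) (fmap_proper_filter _ FF).
  by apply: (@filterS _ F _ setT) => [z _|]; [exact: set_valP|exact: filterT].
exists (SigSub (mem_set Dx)); split=> // B C FB nC.
have [U [[V oV VU] Ux UC]] := nC.
have [||_ [[z Bz <-] Vz]] := clx (set_val @` B) V.
- by apply: (@filterS _ F _ B) => // z Bz; exists z.
- by apply: open_nbhs_nbhs; split => //; move: Ux; rewrite -VU.
by exists z; split => //; apply: UC; rewrite -VU.
Qed.

(** By compactness, finitely many rational cuts of the functions [u i] separate a point from the
    complement of a neighborhood, so finite intersections of open half-spaces form a base. *)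
Lemma weight_family (R : realType) (A I : Type) (X : topologicalType)
    (u : I -> X -> R) : ~ countable [set: A] -> compact_hausdorff X ->
  [set: I] #< [set: A] -> (forall i, continuous (u i)) ->
  (forall x y, (forall i, u i x = u i y) -> x = y) -> weight X #< [set: A].
Proof.
move=> hA hX Is cu sep.
(* [g true t] and [g false t] are the opposite open sides of one cut: the former is to contain [x],
   the latter to cover part of the complement of [V]. *)
pose g (b : bool) (t : I * (rat * bool)) : set X :=
  if t.2.2 (+) b then [set x | (u t.1 x < ratr t.2.1)%R]
  else [set x | (ratr t.2.1 < u t.1 x)%R].
have og b t : open (g b t).
  rewrite /g; case: ifP => _.
    by apply: (@open_comp _ _ (u t.1) [set x | (x < ratr t.2.1)%R]) => //; exact: open_lt.
  by apply: (@open_comp _ _ (u t.1) [set x | (ratr t.2.1 < x)%R]) => //; exact: open_gt.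
pose J s := foldr (fun t Y => g true t `&` Y) setT s.
have oJ s : open (J s).
  by elim: s => [|t s IH]; [exact: openT|exact: openI].
apply: card_lt_le ((weightP X).2 (range J) _) _.
  split=> [_ [s _ <-]|x W Wx]; first exact: oJ.
  rewrite nbhsE in Wx; have [V [oV Vx] VW] := Wx.
  have cV : compact (~` V).
    by apply: subclosed_compact hX.1 (@subsetT _ _); rewrite closedC.
  have [//|y nVy|s Ds Vs] := @compact_seq_cover X _ (~` V)
      [set t | g true t x] (g false) cV.
    have /existsNP[i /eqP] : ~ (forall i, u i x = u i y).
      by move=> /sep e; apply: nVy; rewrite -e.
    rewrite neq_lt => /orP[] /rat_in_itvoo[q]; rewrite in_itv /= => /andP[lt1 lt2].
      by exists (i, (q, false)).
    by exists (i, (q, true)).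
  exists (J s); first (split; first by exists s).
    by elim: s Ds {Vs} => //= t s IH [gx /IH Jx].
  apply: subset_trans VW => y Jy; apply: contrapT => /Vs.
  elim: s Jy {Ds Vs} => //= t s IH [gy /IH nJ] [|//].
  move: gy; rewrite /g; case: t.2.2 => /= l1 l2.
    by have := lt_trans l1 l2; rewrite ltxx.
  by have := lt_trans l1 l2; rewrite ltxx.
apply: card_lt_le (card_image_le _ _) _.
have seqT s : seq_in [set: I * (rat * bool)] s by elim: s.
apply: card_lt_le (card_lt_seq hA (card_lt_setX hA Is _)); last first.
  exact: (countable_card_lt hA (countableP [set: rat * bool])).
by apply: subset_card_le => s _ /=; rewrite setXTT.
Qed.

Section necessity.
Variables (R : realType) (A : Type) (K : topologicalType).
Hypotheses (hA : ~ countable [set: A]) (hK : compact_hausdorff K).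
Hypothesis projK : projective (fun (L M : topologicalType) (p : L -> M) =>
  [/\ compact_surjection p, weight L #< [set: A] & weight M #< [set: A]]) K.

Section split.
Variables (I : Type) (u : I -> K -> R) (X Y : set K).
Hypotheses (Is : [set: I] #< [set: A]) (cu : forall i, continuous (u i)).
Hypotheses (cX : closed X) (cY : closed Y) (XY : X `|` Y = setT).
Hypothesis Xsat : forall k k', (forall i, u i k = u i k') -> X k -> X k'.
Hypothesis Ysat : forall k k', (forall i, u i k = u i k') -> Y k -> Y k'.

Local Notation cube := (prod_topology (fun _ : {classic I} => R)).

Let e (k : K) : cube := fun i => u i k.

Let continuous_e : continuous e.
Proof.
move=> k; apply/cvg_sup => i.
by apply: (@continuous_comp_initial _ _ _ (fun f : cube => f i)); exact: cu.
Qed.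

Let hausdorff_cube : hausdorff_space cube.
Proof. apply: hausdorff_product => _; exact: Rhausdorff. Qed.

Let continuous_coord (i : I) : continuous (fun z : cube => z i).
Proof. exact: (@proj_continuous {classic I} (fun=> R) i). Qed.

Let DM := range e.
Let DL := [set z : cube * bool | if z.2 then (e @` X) z.1 else (e @` Y) z.1].

Let compact_image (Z : set K) : closed Z -> compact (e @` Z).
Proof.
move=> cZ; apply: continuous_compact; first exact: continuous_subspaceT.
exact: subclosed_compact cZ hK.1 (@subsetT _ _).
Qed.

Let compact_DL : compact DL.
Proof.
have -> : DL = ((e @` X) `*` [set true]) `|` ((e @` Y) `*` [set false]).
  apply/seteqP; split=> [[z [] /= Dz]|[z b] [] [/= Dz ->] //]; first by left.
  by right.
by apply: compactU; apply: compact_setX; try exact: compact_set1;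
  exact: compact_image.
Qed.

Let M : topologicalType := set_type DM.
Let L : topologicalType := set_type DL.

Let valM : M -> cube := set_val.
Let valL : L -> cube * bool := set_val.

Let cvalM : continuous valM. Proof. exact: initial_continuous. Qed.
Let cvalL : continuous valL. Proof. exact: initial_continuous. Qed.

Let hM : compact_hausdorff M.
Proof.
split; first exact/compact_subtype/compact_image/closedT.
exact: hausdorff_inj cvalM val_inj hausdorff_cube.
Qed.

Let hL : compact_hausdorff L.
Proof.
split; first exact/compact_subtype.
apply: hausdorff_inj cvalL val_inj _; apply: hausdorff_prod.
  exact: hausdorff_cube.
exact: discrete_hausdorff.
Qed.

Let wM : weight M #< [set: A].
Proof.
apply: (@weight_family R A I M (fun i m => valM m i)) => //.
- move=> i m; apply: (@continuous_comp _ _ _ valM (fun z : cube => z i)).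
    exact: cvalM.
  exact: continuous_coord.
- by move=> x y xy; apply: val_inj; apply/funext => i; exact: xy.
Qed.

Let wL : weight L #< [set: A].
Proof.
have optS : [set: option I] #< [set: A].
  have -> : [set: option I] = Some @` setT `|` [set None].
    by apply/seteqP; split=> // -[i|] _; [left; exists i|right].
  apply: (card_lt_setU hA); first exact: card_lt_le (card_image_le _ _) Is.
  exact/countable_card_lt/countable1.
(* The coordinates alone do not separate the two copies; the extra index [None] reads the tag. *)
pose v (o : option I) (l : L) : R :=
  if o is Some i then (valL l).1 i else (valL l).2%:R%R.
apply: (@weight_family R A (option I) L v) => //.
- case=> [i|] /= l.
    apply: (@continuous_comp _ _ _ (fst \o valL) (fun z : cube => z i)).
      by apply: continuous_comp; [exact: cvalL|exact: cvg_fst].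
    exact: continuous_coord.
  apply: (@continuous_comp _ _ _ (snd \o valL) (fun b : bool => b%:R%R : R)).
    by apply: continuous_comp; [exact: cvalL|exact: cvg_snd].
  have cbool : continuous (fun b : bool => b%:R%R : R).
    by apply/continuousP => B _; exact: discrete_open.
  exact: cbool.
- move=> x y xy; apply: val_inj.
  rewrite -[LHS]/(valL x) -[RHS]/(valL y).
  have /funext e1 : (valL x).1 =1 (valL y).1 by move=> i; exact: (xy (Some i)).
  have := xy None; rewrite /v; move: e1.
  case: (valL x) (valL y) => [z b] [z' b'] /= -> /eqP.
  by rewrite eqr_nat; case: b b' => [] [].
Qed.

Let p_subproof (l : L) : DM (valL l).1.
Proof.
have := set_valP l; rewrite /DL /=.
by case: ifP => _ [k _ ek]; exists k.
Qed.

Let p (l : L) : M := SigSub (mem_set (p_subproof l)).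

Let f_subproof (k : K) : DM (e k). Proof. by exists k. Qed.

Let f (k : K) : M := SigSub (mem_set (f_subproof k)).

Let compact_surjection_p : compact_surjection p.
Proof.
split=> //.
  apply: continuous_comp_initial => l.
  by apply: (@continuous_comp _ _ _ valL fst); [exact: cvalL|exact: cvg_fst].
move=> m _; have [k _ ek] := set_valP m.
have : (X `|` Y) k by rewrite XY.
move=> [Xk|Yk].
  have Dl : DL (e k, true) by exists k.
  exists (SigSub (mem_set Dl)) => //; apply: val_inj; exact: ek.
have Dl : DL (e k, false) by exists k.
exists (SigSub (mem_set Dl)) => //; apply: val_inj; exact: ek.
Qed.

(** [P] is the set where the lift takes the tag [true]. There [e k] lies in the image of [X], and
    saturation of [X] brings [k] itself into [X]; likewise for [Y] off [P]. *)
Lemma clopen_splitting : exists P, [/\ clopen P, P `<=` X & ~` P `<=` Y].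
Proof.
have cf : continuous f by apply: continuous_comp_initial; exact: continuous_e.
have [g cg pg] := projK (And3 compact_surjection_p wL wM) cf.
have pgk k : (valL (g k)).1 = e k.
  by have := congr1 (fun h => valM (h k)) pg.
have cb : continuous (fun k => (valL (g k)).2).
  move=> k; apply: (@continuous_comp _ _ _ (valL \o g) snd); last exact: cvg_snd.
  by apply: continuous_comp; [exact: cg|exact: cvalL].
exists [set k | (valL (g k)).2]; split.
- split.
    by apply: (@open_comp _ _ (fun k => (valL (g k)).2) [set b | b]) => //;
      exact: discrete_open.
  by apply: (@preimage_closed _ _ (fun k => (valL (g k)).2) [set b | b]) => //;
    exact: discrete_closed.
- move=> k /= gk; have : DL (valL (g k)) by exact: set_valP.
  rewrite /DL /= gk pgk => -[k' Xk' ek'].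
  by apply: Xsat Xk' => i; exact: (congr1 (fun z : cube => z i) ek').
- move=> k /= /negP/negbTE gk; have : DL (valL (g k)) by exact: set_valP.
  rewrite /DL /= gk pgk => -[k' Yk' ek'].
  by apply: Ysat Yk' => i; exact: (congr1 (fun z : cube => z i) ek').
Qed.

End split.

Lemma projective_clopen_basis : clopen_basis K.
Proof.
split=> [U [] //|k W kW].
have [V [oV Vk] VW] : exists2 V, open_nbhs k V & V `<=` W by move: kW; rewrite nbhsE.
have [|||h [ch h0 h1]] := @urysohn_function R K hK [set k] (~` V).
- exact: closed_point.
- by rewrite closedC.
- by apply/seteqP; split=> // z [/= -> nV]; exact: nV.
(* The cut is made at the middle value: [h k = 0] keeps [k] out of the second set, and [h = 1] off
   [V] keeps the first set inside [V]. *)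
have [|||||||P [cP PX PY]] := @clopen_splitting unit (fun=> h)
    [set x | (h x <= 2^-1)%R] [set x | (2^-1 <= h x)%R].
- exact: countable_card_lt.
- by [].
- by apply: (@preimage_closed _ _ h [set x | (x <= 2^-1)%R]) => //; exact: closed_le.
- by apply: (@preimage_closed _ _ h [set x | (2^-1 <= x)%R]) => //; exact: closed_ge.
- apply/seteqP; split=> // x _; have [le|/ltW le] := lerP (h x) 2^-1%R;
    by [left|right].
- by move=> x y /(_ tt)/= ->.
- by move=> x y /(_ tt)/= ->.
exists P; first split=> //.
  apply: contrapT => /PY /=; rewrite h0// leNgt invr_gt0 ltr0n; exact/negP.
apply: subset_trans VW => x /PX /= hx; apply: contrapT => nVx.
by move: hx; rewrite h1// leNgt invf_lt1 ?ltr1n ?ltr0n.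
Qed.

Lemma projective_F_space : F_space A K.
Proof.
move=> U V oU oV [F [Fs Fc UF]] [G [Gs Gc VG]] UV0.
(* The constant [0] serves the pairs to which Urysohn's lemma does not apply, so that [h] can be
   chosen for all pairs. *)
have ury W C : exists h : K -> R, continuous h /\ (open W -> closed C -> C `<=` W ->
    (forall k, C k -> h k = 1%R) /\ (forall k, ~ W k -> h k = 0%R)).
  have [[oW cC CW]|nP] := pselect [/\ open W, closed C & C `<=` W]; last first.
    exists (fun=> 0%R); split=> [x|oW cC CW]; first exact: cvg_cst.
    by case: nP.
  have [|||h [ch h0 h1]] := @urysohn_function R K hK (~` W) C.
  - by rewrite closedC.
  - by [].
  - by apply/seteqP; split=> // z [/= nW /CW].
  by exists h.
have /choice[h hP] : forall x : set K * set K, exists h : K -> R, continuous h /\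
    (open x.1 -> closed x.2 -> x.2 `<=` x.1 ->
    (forall k, x.2 k -> h k = 1%R) /\ (forall k, ~ x.1 k -> h k = 0%R)).
  by move=> [W C]; exact: ury.
pose D := ([set U] `*` F) `|` ([set V] `*` G).
(* A point of [W] lies in some piece [C], where the function of [(W, C)] is [1], while it vanishes
   off [W]. So points with equal values are both in [W] or both outside. *)
have sat W E : open W -> E `<=` closed -> W = \bigcup_(C in E) C ->
    [set W] `*` E `<=` D ->
    forall k k', (forall i : D, h (set_val i) k = h (set_val i) k') ->
    (~` W) k -> (~` W) k'.
  move=> oW Ec WE sub k k' hk nWk; rewrite {1}WE => -[C EC Ck'].
  have DC : D (W, C) by apply: sub.
  have CW : C `<=` W by rewrite WE; exact: bigcup_sup.
  have [_ /(_ oW (Ec _ EC) CW)[h1 h0]] := hP (W, C).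
  have := hk (SigSub (mem_set DC)).
  rewrite /= h0// h1// => /eqP; rewrite eq_sym oner_eq0.
  by [].
have [|||||||P [[oP cP] PX PY]] :=
    @clopen_splitting D (fun i => h (set_val i)) (~` V) (~` U).
- apply: (@card_lt_le _ _ _ D).
    by have := card_setT D; rewrite card_eq_le => /andP[].
  apply: (card_lt_setU hA).
    apply: (card_lt_setX hA _ Fs); exact/countable_card_lt/countable1.
  apply: (card_lt_setX hA _ Gs); exact/countable_card_lt/countable1.
- by move=> i; have [] := hP (set_val i).
- by rewrite closedC.
- by rewrite closedC.
- by rewrite -setCI setIC UV0 setC0.
- by apply: sat VG _ => //; exact: subsetUr.
- by apply: sat UF _ => //; exact: subsetUl.
apply/seteqP; split=> // k [clU clV].
(* The cover consists of the complements of [V] and [U], so the clopen set contains [U] and misses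
   [V], and hence separates their closures. *)
have UP : U `<=` P by move=> x Ux; apply: contrapT => /PY.
have VP : V `<=` ~` P by move=> x Vx /PX.
have Pk : P k by apply: cP; exact: (closureS UP).
have : (~` P) k.
  have cP' : closed (~` P) by rewrite closedC.
  by apply: cP'; exact: (closureS VP).
by [].
Qed.

End necessity.

(** The surjections with both weights small belong to all three classes, so the consequences of
    projectivity need to be drawn from this class only. *)
Lemma small_projective (A : Type) (K : topologicalType)
    (C : forall L M : topologicalType, (L -> M) -> Prop) :
  (forall (L M : topologicalType) (p : L -> M), compact_surjection p ->
     weight L #< [set: A] -> weight M #< [set: A] -> C L M p) ->
  projective C K ->
  projective (fun (L M : topologicalType) (p : L -> M) =>
    [/\ compact_surjection p, weight L #< [set: A] & weight M #< [set: A]]) K.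
Proof. by move=> sub projC L M p [pP wL wM]; apply: projC; exact: sub. Qed.

Unset Implicit Arguments.

Theorem theorem6p4 (A : Type) (hA : ~ countable [set: A])
    (K : topologicalType) (hK : compact_hausdorff K) :
  [<-> clopen_basis K /\ F_space A K;
       projective (fun (L M : topologicalType) (p : L -> M) =>
         compact_surjection p /\ weight L #< [set: A]) K;
       projective (fun (L M : topologicalType) (p : L -> M) =>
         [/\ compact_surjection p, weight M #< [set: A]
           & weight L #<= [set: A]]) K;
       projective (fun (L M : topologicalType) (p : L -> M) =>
         compact_surjection p /\ HL A L) K].
Proof.
pose R : realType := Rdefinitions.R.
have toP0 (C : forall L M : topologicalType, (L -> M) -> Prop) :
    (forall (L M : topologicalType) (p : L -> M), compact_surjection p ->
      weight L #< [set: A] -> weight M #< [set: A] -> C L M p) ->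
    projective C K -> clopen_basis K /\ F_space A K.
  move=> sub projC; have projs := small_projective sub projC.
  by split; [exact: (projective_clopen_basis R hA hK projs)
            |exact: (projective_F_space R hA hK projs)].
have P0P3 : clopen_basis K /\ F_space A K ->
    projective (fun (L M : topologicalType) (p : L -> M) =>
      compact_surjection p /\ HL A L) K.
  by move=> [zK FK] L M p [pP HLL] f cf; exact: (lift_HL R hA hK zK FK pP cf).
have P3P1 : projective (fun (L M : topologicalType) (p : L -> M) =>
      compact_surjection p /\ HL A L) K ->
    projective (fun (L M : topologicalType) (p : L -> M) =>
      compact_surjection p /\ weight L #< [set: A]) K.
  move=> projHL L M p [pP wL]; apply: projHL; split=> //.
  by apply: HL_weight wL; case: pP.
(* The cycle is closed through the topological condition: it yields lifting for [HL] spaces, which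
   covers small weight by [HL_weight], and each projectivity condition gives it back by [toP0]. *)
tfae.
- by move=> /P0P3/P3P1.
- move=> /toP0[|zK FK]; first by move=> L M p pP wL wM.
  move=> L M p [pP wM wL] f cf.
  exact: (lift_weight R hA hK zK FK pP cf).
- by move=> /toP0 P0; apply/P0P3/P0 => L M p pP /andP[wL _] wM.
- move=> /P3P1/toP0; apply=> L M p pP wL wM; by split.
Qed.
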